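(* Let $X$ be a complex Banach space with the Daugavet property. Then, for every scalar polynomial $p\colon X\to\mathbb{C}$ which is weakly continuous on bounded sets and satisfies $\|p\|=1$, every $a\in X$ with $\|a\|=1$, and every $\varepsilon>0$, there are $x\in\mathcal{B}_X$ and $w\in\mathbb{C}$ with $|w|=1$ such that $$\operatorname{Re}\, w\,p(x)>1-\varepsilon\quad\text{and}\quad \|a+wx\|>2-\varepsilon.$$ As a consequence, every weakly compact polynomial $P\colon X\to X$ which is weakly continuous on bounded sets satisfies $\|\mathrm{Id}_X+P\|=1+\|P\|$.
   Context: $\mathcal{B}_X$ denotes the closed unit ball of $X$. Polynomials: for complex Banach spaces $X,Y$, a (continuous) $N$-homogeneous polynomial from $X$ to $Y$ is a map $P\colon X\to Y$ of the form $P(x)=T(x,\ldots,x)$ for some continuous symmetric $N$-linear map $T\colon X^N\to Y$ (constant maps are the $0$-homogeneous polynomials). A polynomial from $X$ to $Y$ is a finite sum of such homogeneous polynomials. Its norm is $\|P\|=\sup\{\|P(x)\|:\|x\|\le 1\}$. $P$ is weakly compact if the closure of $P(\mathcal{B}_X)$ is weakly compact. $P$ is weakly continuous on bounded sets if its restriction to each bounded subset of $X$ is continuous from the relative weak topology to the norm topology of $Y$. Daugavet property of $X$: $\|\mathrm{Id}_X+T\|=1+\|T\|$ for all rank-one bounded linear operators $T\colon X\to X$ (equivalently, for all weakly compact linear operators $T\colon X\to X$). *)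

(* Defs.v *)
From HB Require Import structures.
From mathcomp Require Import all_boot all_order all_algebra perm.
From mathcomp Require Import complex.
From mathcomp Require Import all_classical all_reals all_analysis.

Set Implicit Arguments.
Unset Strict Implicit.
Unset Printing Implicit Defensive.

Import Order.TTheory GRing.Theory Num.Theory.
Import numFieldNormedType.Exports.

Local Open Scope classical_set_scope.
Local Open Scope ring_scope.
Local Open Scope complex_scope.

(* In a normed space over [R[i]] the library norm [`|x|] is an element of
   [R[i]] with zero imaginary part; [rnorm x] is the same number seen in [R]. *)
Definition rnorm (R : realType) (X : normedModType R[i]) (x : X) : R :=
  complex.Re `|x|.

Definition unit_ball (R : realType) (X : normedModType R[i]) : set X :=
  [set x | rnorm x <= 1].
Arguments unit_ball {R} X.

(* Only meaningful for maps bounded on the unit ball, such as polynomials and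
   continuous linear operators: [sup] is [0] on sets without upper bound. *)
Definition sup_norm (R : realType) (X Y : normedModType R[i]) (P : X -> Y) : R :=
  sup [set rnorm (P x) | x in unit_ball X].

Definition dual (R : realType) (X : normedModType R[i]) : Type :=
  {f : {linear X -> R[i]^o} | continuous f}.

(* [weak X] is [X] with its weak topology, the coarsest one for which all the
   elements of the dual are continuous. *)
Definition weak (R : realType) (X : normedModType R[i]) : Type :=
  sup_topology (fun f : dual X =>
    Topological.class (initial_topology (sval f : X -> R[i]^o))).

HB.instance Definition _ (R : realType) (X : normedModType R[i]) :=
  Topological.copy (weak X) (sup_topology (fun f : dual X =>
    Topological.class (initial_topology (sval f : X -> R[i]^o)))).

Definition multilinear (R : realType) (X Y : normedModType R[i]) (N : nat)
    (T : ('I_N -> X) -> Y) : Prop :=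
  forall (x : 'I_N -> X) (i : 'I_N), linear (fun u : X => T (dfwith x i u)).

Definition symmetric_map (X Y : Type) (N : nat) (T : ('I_N -> X) -> Y) : Prop :=
  forall (s : 'S_N) (x : 'I_N -> X), T (fun i => x (s i)) = T x.

(* [{ptws 'I_N -> X}] is the product space X^N. For [N = 0] it is a single
   point, and the 0-homogeneous polynomials are the constant maps. *)
Definition homogeneous_polynomial (R : realType) (X Y : normedModType R[i])
    (N : nat) (P : X -> Y) : Prop :=
  exists T : {ptws 'I_N -> X} -> Y,
    [/\ continuous T, symmetric_map T, multilinear T &
        forall x, P x = T (fun=> x)].

Definition polynomial_map (R : realType) (X Y : normedModType R[i])
    (P : X -> Y) : Prop :=
  exists (n : nat) (deg : 'I_n -> nat) (Q : 'I_n -> X -> Y),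
    (forall k, homogeneous_polynomial (deg k) (Q k)) /\
    (forall x, P x = \sum_(k < n) Q k x).

(* The closure is taken in norm, and its compactness in the weak topology. *)
Definition weakly_compact (R : realType) (X Y : normedModType R[i])
    (P : X -> Y) : Prop :=
  @compact (weak Y) (@closure Y (P @` unit_ball X)).

Definition weakly_continuous_on_bounded_sets (R : realType)
    (X Y : normedModType R[i]) (P : X -> Y) : Prop :=
  forall A : set X, bounded_set A ->
    {within (A : set (weak X)), continuous (P : weak X -> Y)}.

Definition rank_one (R : realType) (X : normedModType R[i])
    (T : X -> X) : Prop :=
  exists2 y : X, y != 0 & range T = [set c *: y | c in [set: R[i]]].

Definition daugavet_property (R : realType) (X : normedModType R[i]) : Prop :=
  forall T : {linear X -> X}, continuous T -> rank_one T ->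
    sup_norm (fun x => x + T x) = 1 + sup_norm T.

(* Main.v *)
(* A slice of the ball of [X] contains points [x] with [|a + x|] almost [2]: this
   is the Daugavet equation for rank-one operators.  Convex combinations of such
   slices inherit the property, since adding the summands one at a time keeps
   the norm almost additive.  By a finite-dimensional form of Bourgain's lemma,
   every weakly open subset of the ball contains such a convex combination, so
   near any [x0] of the ball, in the weak topology, there are [x] with [|a + x|]
   almost [2].  By weak continuity the polynomial hardly changes from [x0] to
   [x], so [x0] can be taken almost norming for it; [a] is the given vector up to
   a rotation in the scalar case, and the direction of [P x0] in the case of
   [P : X -> X]. *)
Require Import Defs.
From HB Require Import structures.
From mathcomp Require Import all_boot all_order all_algebra.
From mathcomp Require Import complex.
From mathcomp Require Import all_classical all_reals all_analysis.
From mathcomp Require Import ring lra.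

Set Implicit Arguments.
Unset Strict Implicit.
Unset Printing Implicit Defensive.

Import Order.TTheory GRing.Theory Num.Theory.
Import numFieldNormedType.Exports.

Local Open Scope classical_set_scope.
Local Open Scope ring_scope.
Local Open Scope complex_scope.

(** * Real parts, the real-valued norm and the supremum norm *)

Lemma Re_realM (R : realType) (t : R) (z : R[i]) :
  complex.Re (t%:C * z) = t * complex.Re z.
Proof. by case: z => a b /=; rewrite mul0r subr0. Qed.

Lemma ReD (R : realType) (z w : R[i]) :
  complex.Re (z + w) = complex.Re z + complex.Re w.
Proof. by case: z w => [a b] [c d]. Qed.

Lemma Re_sum (R : realType) (I : Type) (r : seq I) (F : I -> R[i]) :
  complex.Re (\sum_(i <- r) F i) = \sum_(i <- r) complex.Re (F i).
Proof. by apply: (big_morph _ (@ReD R)). Qed.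

Lemma normrE_rnorm (R : realType) (X : normedModType R[i]) (x : X) :
  `|x| = (rnorm x)%:C.
Proof. by rewrite /rnorm RRe_real// normr_real. Qed.

Lemma rnorm_ge0 (R : realType) (X : normedModType R[i]) (x : X) :
  0 <= rnorm x.
Proof. by rewrite -ler0c -normrE_rnorm. Qed.

Lemma rnorm0 (R : realType) (X : normedModType R[i]) : rnorm (0 : X) = 0.
Proof. by rewrite /rnorm normr0. Qed.

Lemma rnorm_eq0 (R : realType) (X : normedModType R[i]) (x : X) :
  (rnorm x == 0) = (x == 0).
Proof. by rewrite -[RHS]normr_eq0 normrE_rnorm eq_complex /= eqxx andbT. Qed.

Lemma rnorm_gt0 (R : realType) (X : normedModType R[i]) (x : X) :
  (0 < rnorm x) = (x != 0).
Proof. by rewrite lt_def rnorm_ge0 andbT rnorm_eq0. Qed.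

Lemma rnormN (R : realType) (X : normedModType R[i]) (x : X) :
  rnorm (- x) = rnorm x.
Proof. by rewrite /rnorm normrN. Qed.

Lemma rnormD (R : realType) (X : normedModType R[i]) (x y : X) :
  rnorm (x + y) <= rnorm x + rnorm y.
Proof. by rewrite -lecR rmorphD /= -!normrE_rnorm ler_normD. Qed.

Lemma rnormB (R : realType) (X : normedModType R[i]) (x y : X) :
  rnorm (x - y) <= rnorm x + rnorm y.
Proof. by rewrite -(rnormN y) rnormD. Qed.

Lemma rnorm_sum (R : realType) (X : normedModType R[i]) (I : Type)
    (r : seq I) (F : I -> X) :
  rnorm (\sum_(i <- r) F i) <= \sum_(i <- r) rnorm (F i).
Proof.
elim/big_ind2: _ => [|x1 x2 y1 y2 h1 h2|//]; first by rewrite rnorm0.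
by rewrite (le_trans (rnormD _ _))// lerD.
Qed.

Lemma rnormZ (R : realType) (X : normedModType R[i]) (c : R[i]) (x : X) :
  rnorm (c *: x) = rnorm (c : R[i]^o) * rnorm x.
Proof. by apply: complexI; rewrite rmorphM /= -!normrE_rnorm normrZ. Qed.

Lemma rnormZr (R : realType) (X : normedModType R[i]) (t : R) (x : X) :
  rnorm (t%:C *: x) = `|t| * rnorm x.
Proof.
rewrite rnormZ; congr (_ * _); rewrite /rnorm normc_def /=.
by rewrite expr0n addr0 sqrtr_sqr.
Qed.

Lemma Re_le_rnorm (R : realType) (z : R[i]) :
  `|complex.Re z| <= rnorm (z : R[i]^o).
Proof. by rewrite -lecR -normrE_rnorm; apply: normc_ge_Re. Qed.

Lemma exists_rotation (R : realType) (z : R[i]) :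
  exists2 w : R[i], `|w| = 1 & w * z = (rnorm (z : R[i]^o))%:C.
Proof.
have [->|z0] := eqVneq z 0; first by exists 1; rewrite ?normr1// mulr0 rnorm0.
exists (`|z| / z); first by rewrite normrM normfV normr_id divff// normr_eq0.
by rewrite divfK// -(normrE_rnorm (z : R[i]^o)).
Qed.

Lemma rnorm_unit (R : realType) (X : normedModType R[i]) (w : R[i]) (x : X) :
  `|w| = 1 -> rnorm (w *: x) = rnorm x.
Proof. by move=> w1; rewrite /rnorm normrZ w1 mul1r. Qed.

Lemma unit_ball_nonempty (R : realType) (X : normedModType R[i]) (T : Type)
    (f : X -> T) : [set f x | x in unit_ball X] !=set0.
Proof. by exists (f 0), 0 => //; rewrite /unit_ball /= rnorm0. Qed.

Lemma sup_norm_adherent (R : realType) (X Y : normedModType R[i]) (P : X -> Y)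
    (t : R) :
  t < sup_norm P -> exists2 x, unit_ball X x & t < rnorm (P x).
Proof.
by move=> /(sup_gt (unit_ball_nonempty _))[_ [x Bx <-] tx]; exists x.
Qed.

Lemma sup_norm_upper_bound (R : realType) (X Y : normedModType R[i])
    (P : X -> Y) (M : R) :
  (forall x, unit_ball X x -> rnorm (P x) <= M) ->
  forall x, unit_ball X x -> rnorm (P x) <= sup_norm P.
Proof.
move=> PM x Bx; apply: ub_le_sup; last by exists x.
by exists M => _ [y By <-]; exact: PM.
Qed.

Lemma sup_norm_le (R : realType) (X Y : normedModType R[i]) (P : X -> Y)
    (M : R) :
  (forall x, unit_ball X x -> rnorm (P x) <= M) -> sup_norm P <= M.
Proof.
by move=> PM; apply: ge_sup (unit_ball_nonempty _) _ => _ [y By <-]; exact: PM.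
Qed.

Lemma unit_ball_bounded (R : realType) (X : normedModType R[i]) :
  bounded_set (unit_ball X).
Proof.
exists 1; split; first exact: real1.
move=> r r1 x /=; rewrite /unit_ball /= => x1; apply: le_trans (ltW r1).
by rewrite normrE_rnorm -[1]/(1%:C) lecR.
Qed.

Lemma continuous_linear_rnorm_bound (R : realType) (X Y : normedModType R[i])
    (f : {linear X -> Y}) :
  continuous f -> exists M : R, forall x, unit_ball X x -> rnorm (f x) <= M.
Proof.
move/linear_bounded_continuous/bounded_funP => /(_ 1)[M fM].
exists (complex.Re M) => x x1; have := fM x.
rewrite normrE_rnorm -[1]/(1%:C) lecR => /(_ x1).
by rewrite normrE_rnorm lecE => /andP[].
Qed.

(** * Rank-one operators and slices of the ball *)

Definition rank_one_map (R : realType) (X : normedModType R[i])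
    (g : {linear X -> R[i]^o}) (a : X) (x : X) : X := (g x : R[i]) *: a.

Lemma rank_one_map_is_linear (R : realType) (X : normedModType R[i])
    (g : {linear X -> R[i]^o}) (a : X) : linear (rank_one_map g a).
Proof.
by move=> c x y; rewrite /rank_one_map linearP scalerDl scalerA.
Qed.

HB.instance Definition _ (R : realType) (X : normedModType R[i])
    (g : {linear X -> R[i]^o}) (a : X) :=
  GRing.isLinear.Build R[i] X X _ (rank_one_map g a)
    (rank_one_map_is_linear g a).

Lemma rank_one_map_continuous (R : realType) (X : normedModType R[i])
    (g : {linear X -> R[i]^o}) (a : X) :
  continuous g -> continuous (rank_one_map g a).
Proof. by move=> gc x; apply: cvgZr_tmp; exact: gc. Qed.

Lemma rank_one_map_rank_one (R : realType) (X : normedModType R[i])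
    (g : {linear X -> R[i]^o}) (a x0 : X) :
  rank_one_map g a x0 != 0 -> rank_one (rank_one_map g a).
Proof.
rewrite /rank_one_map scaler_eq0 negb_or => /andP[gx0 a0]; exists a => //.
apply/seteqP; split=> [_ [x _ <-]|_ [c _ <-]]; first by exists (g x).
exists (c / g x0 *: x0) => //.
by rewrite linearZ /= /GRing.scale /= divfK.
Qed.

(* Applied to [x |-> g x a], the Daugavet equation yields a point [x] of the
   ball at which [|g|] and [|x + g x a|] are both almost maximal; rotating [x]
   makes [g x] positive, and then [a] and [x] are almost aligned. *)
Lemma daugavet_slice (R : realType) (X : normedModType R[i])
    (g : {linear X -> R[i]^o}) (a x1 : X) (eta eps : R) :
  daugavet_property X -> continuous g -> rnorm a = 1 -> unit_ball X x1 ->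
  0 < eta -> 0 < eps ->
  exists x, [/\ unit_ball X x, complex.Re (g x1) - eta < complex.Re (g x) &
                2 - eps < rnorm (a + x)].
Proof.
move=> XD gc a1 Bx1 eta0 eps0; pose T := rank_one_map g a.
have Tc : continuous T by exact: rank_one_map_continuous.
have rT x : rnorm (T x) = rnorm (g x) by rewrite rnormZ a1 mulr1.
have [M /sup_norm_upper_bound Ts] := continuous_linear_rnorm_bound Tc.
have {Ts} gs x : unit_ball X x -> rnorm (g x) <= sup_norm T.
  by move=> /Ts; rewrite rT.
(* If [T] vanishes on the ball it is not of rank one and the Daugavet equation says nothing, but
   then [x = a] works, as [a + a] has norm 2. *)
have [s0|s0] := leP (sup_norm T) 0.
  have g0 x : unit_ball X x -> complex.Re (g x) = 0.
    move=> /gs gx; apply/eqP; rewrite -normr_eq0 eq_le normr_ge0 andbT.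
    by rewrite (le_trans (Re_le_rnorm _))// (le_trans gx).
  have Ba : unit_ball X a by rewrite /unit_ball /= a1.
  exists a; split=> //; first by rewrite !g0// sub0r oppr_lt0.
  rewrite -[a]scale1r -scalerDl.
  have -> : 1 + 1 = (2 : R)%:C by rewrite -[1]/(1%:C) -rmorphD.
  by rewrite rnormZr a1 mulr1 ger0_norm// ltrBlDr ltrDl.
set s := sup_norm T in gs s0.
have [x0 _ Tx0] := sup_norm_adherent s0.
rewrite rnorm_gt0 in Tx0.
have DT := XD _ Tc (rank_one_map_rank_one Tx0).
(* The bound [eta] serves the slice and [eps] the case [1 <= t]. For [t < 1] the final estimate is
   divided by [t]: the bound [s / 2] gives [t > s / 2], and then [eps * s / 2] gives
   [e < t * eps]. *)
pose e := Num.min (Num.min eta eps) (Num.min (s / 2) (eps * s / 2)).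
have e0 : 0 < e by rewrite !lt_min eta0 eps0 !divr_gt0// mulr_gt0.
have [e_eta e_eps e_s e_es] : [/\ e <= eta, e <= eps, e <= s / 2 & e <= eps * s / 2].
  by split; rewrite !ge_min lexx ?orbT.
have : 1 + s - e < sup_norm (fun x => x + T x) by rewrite DT -/s ltrBlDr ltrDl.
move=> /sup_norm_adherent[x Bx xT].
have [w w1 wgx] := exists_rotation (g x); set t := rnorm (g x) in wgx.
have ts : t <= s by exact: gs.
have t0 : 0 <= t by exact: rnorm_ge0.
have Bwx : unit_ball X (w *: x) by rewrite /unit_ball /= rnorm_unit.
have gwx : g (w *: x) = t%:C by rewrite linearZ /= -wgx.
have {}xT : 1 + s - e < rnorm (w *: x + t%:C *: a).
  by rewrite -wgx -scalerA -scalerDr rnorm_unit.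
have rta : rnorm (t%:C *: a) = t by rewrite rnormZr a1 mulr1 ger0_norm.
have rx : rnorm (w *: x) <= 1 by [].
have tse : s - e < t.
  by have := rnormD (w *: x) (t%:C *: a); rewrite rta; lra.
exists (w *: x); split=> //.
  rewrite gwx /=; have := Re_le_rnorm (g x1); have := gs _ Bx1.
  by have := ler_norm (complex.Re (g x1)); lra.
have [t1|t1] := leP 1 t.
  have := rnormD (a + w *: x) ((t - 1)%:C *: a).
  have -> : a + w *: x + (t - 1)%:C *: a = w *: x + t%:C *: a.
    rewrite rmorphB /= scalerBl scale1r [a + _]addrC addrA.
    by rewrite [_ + _ + t%:C *: a]addrAC addrK.
  rewrite rnormZr a1 ger0_norm; lra.
have := rnormD (t%:C *: (a + w *: x)) ((1 - t)%:C *: (w *: x)).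
have -> : t%:C *: (a + w *: x) + (1 - t)%:C *: (w *: x) = w *: x + t%:C *: a.
  by rewrite rmorphB /= scalerBl scale1r scalerDr addrACA subrr addr0 addrC.
rewrite !rnormZr !ger0_norm//; last lra.
move=> h; have {}h : t * (2 - eps) < t * rnorm (a + w *: x) by nra.
by rewrite ltr_pM2l// in h; lra.
Qed.

(** * The semi-inner product attached to finitely many functionals *)

(* The finite-dimensional weak geometry is that of the map
   [x |-> (Re (h i x))_i] into a Euclidean space; its semi-inner product is
   pulled back to [X]. *)
Definition real_dot (R : realType) (X : normedModType R[i]) (I : finType)
    (h : I -> {linear X -> R[i]^o}) (x y : X) : R :=
  \sum_i complex.Re (h i x) * complex.Re (h i y).

Lemma real_dotC (R : realType) (X : normedModType R[i]) (I : finType)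
    (h : I -> {linear X -> R[i]^o}) (x y : X) :
  real_dot h x y = real_dot h y x.
Proof. by apply: eq_bigr => i _; rewrite mulrC. Qed.

Lemma real_dotDl (R : realType) (X : normedModType R[i]) (I : finType)
    (h : I -> {linear X -> R[i]^o}) (x y z : X) :
  real_dot h (x + y) z = real_dot h x z + real_dot h y z.
Proof.
by rewrite -big_split; apply: eq_bigr => i _; rewrite linearD ReD mulrDl.
Qed.

Lemma real_dotZl (R : realType) (X : normedModType R[i]) (I : finType)
    (h : I -> {linear X -> R[i]^o}) (t : R) (x z : X) :
  real_dot h (t%:C *: x) z = t * real_dot h x z.
Proof.
by rewrite big_distrr; apply: eq_bigr => i _ /=; rewrite linearZ Re_realM mulrA.
Qed.

Lemma real_dotNl (R : realType) (X : normedModType R[i]) (I : finType)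
    (h : I -> {linear X -> R[i]^o}) (x z : X) :
  real_dot h (- x) z = - real_dot h x z.
Proof.
by rewrite -scaleN1r -[1]/(1%:C) -rmorphN real_dotZl mulN1r.
Qed.

Lemma real_dotDr (R : realType) (X : normedModType R[i]) (I : finType)
    (h : I -> {linear X -> R[i]^o}) (x y z : X) :
  real_dot h z (x + y) = real_dot h z x + real_dot h z y.
Proof. by rewrite !(real_dotC _ z) real_dotDl. Qed.

Lemma real_dotZr (R : realType) (X : normedModType R[i]) (I : finType)
    (h : I -> {linear X -> R[i]^o}) (t : R) (x z : X) :
  real_dot h z (t%:C *: x) = t * real_dot h z x.
Proof. by rewrite !(real_dotC _ z) real_dotZl. Qed.

Lemma real_dotNr (R : realType) (X : normedModType R[i]) (I : finType)
    (h : I -> {linear X -> R[i]^o}) (x z : X) :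
  real_dot h z (- x) = - real_dot h z x.
Proof. by rewrite !(real_dotC _ z) real_dotNl. Qed.

Definition real_dotE := (real_dotDl, real_dotDr, real_dotNl, real_dotNr,
  real_dotZl, real_dotZr).

Lemma real_dot_ge0 (R : realType) (X : normedModType R[i]) (I : finType)
    (h : I -> {linear X -> R[i]^o}) (x : X) : 0 <= real_dot h x x.
Proof. by apply: sumr_ge0 => i _; rewrite -expr2 sqr_ge0. Qed.

(** The functional is the combination of the [h i] with the real coefficients [Re (h i y)]. It makes
    half-spaces of the semi-inner product into slices, to which [daugavet_slice] applies. *)
Lemma real_dot_Re (R : realType) (X : normedModType R[i]) (I : finType)
    (h : I -> {linear X -> R[i]^o}) (y : X) :
  (forall i, continuous (h i)) ->
  exists2 g : {linear X -> R[i]^o}, continuous g &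
    forall x, real_dot h y x = complex.Re (g x).
Proof.
move=> hc; pose g x : R[i]^o := \sum_i (complex.Re (h i y))%:C *: h i x.
have gl : linear g.
  move=> c u v; rewrite /g scaler_sumr -big_split; apply: eq_bigr => i _ /=.
  by rewrite linearP scalerDr !scalerA [c * _]mulrC.
pose G : {linear X -> R[i]^o} :=
  HB.pack g (GRing.isLinear.Build R[i] X R[i]^o _ g gl).
exists G => [x|x].
  apply: (@cvg_big _ _ _ 0); first exact: add_continuous.
  by move=> i _; apply: cvgZl_tmp; exact: hc.
by rewrite /= /g Re_sum; apply: eq_bigr => i _; rewrite Re_realM.
Qed.

Lemma real_dot_bound (R : realType) (X : normedModType R[i]) (I : finType)
    (h : I -> {linear X -> R[i]^o}) :
  (forall i, continuous (h i)) ->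
  exists M, forall x, unit_ball X x -> real_dot h x x <= M.
Proof.
move=> hc.
have /choice [M hM] i := continuous_linear_rnorm_bound (hc i).
exists (\sum_i M i ^+ 2) => x Bx; apply: ler_sum => i _.
rewrite -expr2 -(ger0_norm (le_trans (rnorm_ge0 _) (hM i _ Bx))) -normrX.
rewrite -ler_sqrt ?normr_ge0// normrX !sqrtr_sqr !normr_id.
rewrite [leRHS]ger0_norm ?(le_trans (rnorm_ge0 _) (hM i _ Bx))//.
exact: le_trans (Re_le_rnorm _) (hM i _ Bx).
Qed.

(** * Good points and their convexity *)

Lemma unit_ball_convex (R : realType) (X : normedModType R[i]) (t : R)
    (x y : X) : 0 <= t -> t <= 1 -> unit_ball X x -> unit_ball X y ->
  unit_ball X ((1 - t)%:C *: x + t%:C *: y).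
Proof.
rewrite /unit_ball /= => t0 t1 Bx By.
have := rnormD ((1 - t)%:C *: x) (t%:C *: y).
by rewrite !rnormZr !ger0_norm ?subr_ge0//; nra.
Qed.

(** With [b = s u] and [m] the larger of [s] and [t], the vector [b + t x] differs from [m (u + x)]
    by a multiple of [u] or [x] of norm at most [|s - t|]. The loss is thus at most [m e], and
    [m <= 2]. *)
Lemma rnorm_almost_aligned (R : realType) (X : normedModType R[i]) (b x : X)
    (t e : R) :
  0 < rnorm b -> rnorm b <= 2 -> rnorm x <= 1 -> 0 <= t -> t <= 1 -> 0 < e ->
  2 - e < rnorm ((rnorm b)^-1%:C *: b + x) ->
  rnorm b + t - 2 * e < rnorm (b + t%:C *: x).
Proof.
set s := rnorm b => s0 s2 x1 t0 t1 e0 bx.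
have bE : b = s%:C *: (s^-1%:C *: b).
  by rewrite scalerA -rmorphM /= divff ?gt_eqF// scale1r.
set u := s^-1%:C *: b in bx bE.
have u1 : rnorm u = 1 by rewrite rnormZr gtr0_norm ?invr_gt0// mulVf// gt_eqF.
clearbody u; have se : s * e <= 2 * e by rewrite ler_pM2r.
have te : t * e <= 2 * e by rewrite ler_pM2r//; lra.
rewrite bE; have [ts|st] := leP t s.
  have := rnormB (s%:C *: u + t%:C *: x) ((t - s)%:C *: x).
  have -> : s%:C *: u + t%:C *: x - (t - s)%:C *: x = s%:C *: (u + x).
    by rewrite rmorphB /= scalerBl scalerDr opprB addrACA subrr addr0.
  rewrite !rnormZr distrC !ger0_norm ?subr_ge0 ?(ltW s0)//.
  have : s * (2 - e) < s * rnorm (u + x) by rewrite ltr_pM2l.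
  have : (s - t) * rnorm x <= s - t by rewrite ler_piMr// subr_ge0.
  lra.
have := rnormD (s%:C *: u + t%:C *: x) ((t - s)%:C *: u).
have -> : s%:C *: u + t%:C *: x + (t - s)%:C *: u = t%:C *: (u + x).
  by rewrite rmorphB /= scalerBl scalerDr addrC addrA subrK.
rewrite !rnormZr u1 !ger0_norm ?subr_ge0 ?(ltW st)//.
have : t * (2 - e) < t * rnorm (u + x) by rewrite ltr_pM2l// (lt_trans s0).
lra.
Qed.

(** These [y] are the good points. The tolerance [delta] bounds a squared seminorm. Allowing every
    unit vector [a] is what lets the summands of a convex combination be chosen one after the
    other. *)
Definition daugavet_approx (R : realType) (X : normedModType R[i]) (I : finType)
    (h : I -> {linear X -> R[i]^o}) (delta : R) (y : X) : Prop :=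
  unit_ball X y /\
  forall (a : X) (eps : R), rnorm a = 1 -> 0 < eps ->
  exists x, [/\ unit_ball X x, real_dot h (x - y) (x - y) <= delta &
                2 - eps < rnorm (a + x)].

(** A point [x] near [y] is chosen against [a], then [x'] near [z] against the direction of
    [b = a + (1 - t) x], so that the norms almost add up. *)
Lemma daugavet_approx_convex (R : realType) (X : normedModType R[i]) (I : finType)
    (h : I -> {linear X -> R[i]^o}) (delta t : R) (y z : X) :
  0 <= t -> t <= 1 -> daugavet_approx h delta y -> daugavet_approx h delta z ->
  daugavet_approx h delta ((1 - t)%:C *: y + t%:C *: z).
Proof.
move=> t0 t1 [By yP] [Bz zP]; split=> [|a eps a1 eps0].
  exact: unit_ball_convex.
(* Each of the two additions loses at most [2 * e], hence [eps / 4]; the bound [1 / 4] keeps [b]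
   away from 0. *)
pose e := Num.min (eps / 4) (1 / 4).
have e0 : 0 < e by rewrite lt_min !divr_gt0.
have [e_eps e4] : e <= eps / 4 /\ e <= 1 / 4 by split; rewrite ge_min lexx ?orbT.
have [x [Bx xy ax]] := yP a e a1 e0.
have na : rnorm (1^-1%:C *: a + x) = rnorm (a + x) by rewrite invr1 scale1r.
pose b := a + (1 - t)%:C *: x.
have b_lb : 2 - t - 2 * e < rnorm b.
  have := @rnorm_almost_aligned _ _ a x (1 - t) e.
  rewrite a1 na => H; have : 1 + (1 - t) - 2 * e < rnorm b by apply: H => //; lra.
  lra.
have b_ub : rnorm b <= 2.
  have := rnormD a ((1 - t)%:C *: x).
  by rewrite rnormZr a1 ger0_norm ?subr_ge0// -/b; move: Bx; rewrite /unit_ball /=; nra.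
have b0 : 0 < rnorm b by lra.
have nb : rnorm ((rnorm b)^-1%:C *: b) = 1.
  by rewrite rnormZr gtr0_norm ?invr_gt0// mulVf// gt_eqF.
have [x' [Bx' xz bx']] := zP _ e nb e0.
exists ((1 - t)%:C *: x + t%:C *: x'); split; first exact: unit_ball_convex.
  have -> : (1 - t)%:C *: x + t%:C *: x' - ((1 - t)%:C *: y + t%:C *: z) =
      (1 - t)%:C *: (x - y) + t%:C *: (x' - z).
    by rewrite !scalerBr opprD addrACA.
  set u := x - y in xy *; set v := x' - z in xz *.
  clearbody u v.
  (* For the quadratic form [q], [q((1-t)u + tv) = (1-t)q(u) + tq(v) - t(1-t)q(u-v)], so [delta] is
     not enlarged. *)
  have := real_dot_ge0 h (u - v); rewrite !real_dotE (real_dotC h v u) => uv.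
  have s0 : 0 <= 1 - t by rewrite subr_ge0.
  have := mulr_ge0 (mulr_ge0 t0 s0) uv.
  have := ler_wpM2l s0 xy; have := ler_wpM2l t0 xz; lra.
by rewrite addrA; have := rnorm_almost_aligned b0 b_ub Bx' t0 t1 e0 bx'; rewrite -/b; lra.
Qed.

(** * Existence and weak density of the good points *)

(* A point of the ball almost farthest from [c] lies in a slice of small
   diameter. *)
Lemma daugavet_approx_farthest (R : realType) (X : normedModType R[i])
    (I : finType) (h : I -> {linear X -> R[i]^o}) (delta : R) (c x1 : X) :
  daugavet_property X -> (forall i, continuous (h i)) -> 0 < delta ->
  unit_ball X x1 ->
  (forall x, unit_ball X x ->
     real_dot h (x - c) (x - c) <= real_dot h (x1 - c) (x1 - c) + delta / 3) ->
  daugavet_approx h delta x1.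
Proof.
move=> XD hc delta0 Bx1 x1far; split=> // a eps a1 eps0.
have [g gc gE] := real_dot_Re (x1 - c) hc.
have d3 : 0 < delta / 3 by rewrite divr_gt0.
have [x [Bx gx ax]] := daugavet_slice XD gc a1 Bx1 d3 eps0.
exists x; split=> //; rewrite -!gE in gx.
(* Expanding [x - c = (x - x1) + (x1 - c)] bounds the squared distance from [x] to [x1] by
   [delta / 3] from [x1far] plus twice the slice depth [delta / 3]. *)
have := x1far x Bx; move: gx; rewrite !real_dotE.
by rewrite (real_dotC h c x) (real_dotC h c x1) (real_dotC h x1 x); lra.
Qed.

Lemma exists_daugavet_approx_farthest (R : realType) (X : normedModType R[i])
    (I : finType) (h : I -> {linear X -> R[i]^o}) (delta eta : R) (c : X) :
  daugavet_property X -> (forall i, continuous (h i)) -> 0 < delta -> 0 < eta ->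
  exists2 x1, daugavet_approx h delta x1 &
    forall x, unit_ball X x ->
      real_dot h (x - c) (x - c) <= real_dot h (x1 - c) (x1 - c) + eta.
Proof.
move=> XD hc delta0 eta0; have [M hM] := real_dot_bound hc.
pose E := [set real_dot h (x - c) (x - c) | x in unit_ball X].
have E0 : E !=set0 by exact: unit_ball_nonempty.
have Eub : has_ubound E.
  (* This bound is the parallelogram law with the term in [x + c] dropped. *)
  exists (2 * M + 2 * real_dot h c c) => _ [x Bx <-].
  have := hM x Bx; have := real_dot_ge0 h (x + c); rewrite !real_dotE.
  by rewrite (real_dotC h c x); lra.
pose k := Num.min eta (delta / 3).
have k0 : 0 < k by rewrite lt_min eta0 divr_gt0.
have [k1 k2] : k <= eta /\ k <= delta / 3 by split; rewrite ge_min lexx ?orbT.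
have [_ [x1 Bx1 <-] x1k] := sup_adherent k0 (conj E0 Eub).
have x1far x : unit_ball X x ->
    real_dot h (x - c) (x - c) <= real_dot h (x1 - c) (x1 - c) + k.
  move=> Bx; have : real_dot h (x - c) (x - c) <= sup E.
    by apply: ub_le_sup => //; exists x.
  by rewrite -/E in x1k *; lra.
exists x1 => [|x /x1far]; last lra.
by apply: (daugavet_approx_farthest (c := c)) => // x /x1far; lra.
Qed.

(* Replaces the separation and extreme point arguments in Bourgain's lemma.  Were
   the distance [d] from [x0] to the convex set of good points positive, take a
   good [y] almost realising it, and a good [x1] almost farthest from the centre
   [x0 - tau (x0 - y)] with [tau] large.  Then [x1 - x0] makes an almost
   nonobtuse angle with [x0 - y], so moving from [y] towards [x1] brings [y]
   closer to [x0]. *)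
Lemma daugavet_approx_dense (R : realType) (X : normedModType R[i]) (I : finType)
    (h : I -> {linear X -> R[i]^o}) (delta : R) (x0 : X) :
  daugavet_property X -> (forall i, continuous (h i)) -> 0 < delta ->
  unit_ball X x0 ->
  exists2 y, daugavet_approx h delta y &
    real_dot h (x0 - y) (x0 - y) < delta.
Proof.
move=> XD hc delta0 Bx0; apply: contrapT => far.
have {}far y : daugavet_approx h delta y ->
    delta <= real_dot h (x0 - y) (x0 - y).
  by move=> yP; rewrite leNgt; apply/negP => yd; apply: far; exists y.
pose E := [set real_dot h (x0 - y) (x0 - y) | y in daugavet_approx h delta].
have [y1 y1P _] := exists_daugavet_approx_farthest x0 XD hc delta0 delta0.
have E0 : E !=set0 by exists (real_dot h (x0 - y1) (x0 - y1)), y1.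
have Elb : has_lbound E by exists delta => _ [y yP <-]; exact: far.
pose d := inf E.
have dlb y : daugavet_approx h delta y -> d <= real_dot h (x0 - y) (x0 - y).
  by move=> yP; apply: ge_inf => //; exists y.
have d0 : 0 < d.
  apply: lt_le_trans delta0 _; apply: lb_le_inf => // _ [y yP <-]; exact: far.
have [M0 hM0] := real_dot_bound hc; pose M := 4 * M0 + d.
have hM x y : unit_ball X x -> unit_ball X y ->
    real_dot h (x - y) (x - y) <= M.
  move=> /hM0 xM /hM0 yM; have := real_dot_ge0 h (x + y); rewrite !real_dotE.
  by rewrite (real_dotC h y x) /M; lra.
have M_d : d <= M by apply: le_trans (dlb _ y1P) (hM _ _ Bx0 (proj1 y1P)).
have Mp : 0 < M by exact: lt_le_trans M_d.
(* This slack equals [t * d / 2] for the step length [t] chosen below, which is exactly what the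
   step from [y] gains. *)
have k0 : 0 < d ^+ 2 / (4 * M) by rewrite divr_gt0 ?exprn_gt0 ?mulr_gt0.
have [_ [y yP <-] yd] := inf_adherent k0 (conj E0 Elb).
rewrite -/d in yd.
pose tau := (M + d) / d.
have tauE : tau * d = M + d by rewrite divfK// gt_eqF.
have tau0 : 0 < tau by rewrite divr_gt0// addr_gt0.
have [x1 x1P x1far] := exists_daugavet_approx_farthest (x0 - tau%:C *: (x0 - y))
  XD hc delta0 d0.
have [u uE] : exists u, u = x0 - y by exists (x0 - y).
have [v vE] : exists v, v = x1 - x0 by exists (x1 - x0).
rewrite -uE in yd x1far.
(* Comparing the distances of [x0] and [x1] to the centre cancels the terms in [tau ^ 2] and leaves
   [2 tau <u,v> + M + d >= 0]; by the choice of [tau], [M + d] is [tau * d]. *)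
have uv : - (d / 2) <= real_dot h u v.
  have := x1far x0 Bx0; have := hM x1 x0 (proj1 x1P) Bx0.
  have -> : x0 - (x0 - tau%:C *: u) = tau%:C *: u by rewrite subKr.
  have -> : x1 - (x0 - tau%:C *: u) = v + tau%:C *: u.
    by rewrite vE opprB addrA addrAC.
  rewrite -vE !real_dotE (real_dotC h v u) => vM vu.
  have : 0 <= 2 * tau * real_dot h u v + tau * d by lra.
  have -> : 2 * tau * real_dot h u v + tau * d = tau * (2 * real_dot h u v + d).
    ring.
  by rewrite pmulr_rge0//; lra.
(* Since [<u, v + u> >= d / 2], a step [t] lowers the squared distance by at least [t d - t^2 M];
   this [t] maximises that gain. *)
pose t := d / (2 * M).
have tE : t * (2 * M) = d by rewrite divfK// mulf_neq0// gt_eqF.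
have t0 : 0 < t by rewrite divr_gt0// mulr_gt0.
have t1 : t <= 1 by rewrite ler_pdivrMr ?mulr_gt0//; lra.
have := dlb _ (daugavet_approx_convex (ltW t0) t1 yP x1P).
have -> : x0 - ((1 - t)%:C *: y + t%:C *: x1) = u - t%:C *: (x1 - y).
  rewrite rmorphB /= scalerBl scale1r scalerBr uE opprB opprD opprB !addrA.
  by congr (_ - _); rewrite addrAC.
have -> : x1 - y = v + u by rewrite vE uE addrA subrK.
have := hM x1 y (proj1 x1P) (proj1 yP).
have -> : x1 - y = v + u by rewrite vE uE addrA subrK.
have kE : d ^+ 2 / (4 * M) = t * d / 2.
  by rewrite /t; field; rewrite gt_eqF.
have du : d <= real_dot h u u by rewrite uE; exact: dlb.
rewrite kE in yd; clear kE.
have wE : real_dot h u (v + u) = real_dot h u v + real_dot h u u.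
  exact: real_dotDr.
set w := v + u in wE *; clearbody w.
move=> wM; rewrite !real_dotE (real_dotC h w u) wE.
have h1 : t * (d / 2) <= t * (real_dot h u v + real_dot h u u).
  by rewrite ler_pM2l//; lra.
have h2 : t * (t * real_dot h w w) <= t * (d / 2).
  by rewrite ler_pM2l// -tE; nra.
lra.
Qed.

(** * Weak neighbourhoods and weakly continuous maps *)

Lemma daugavet_weak_nbhs (R : realType) (X : normedModType R[i]) (I : finType)
    (h : I -> {linear X -> R[i]^o}) (delta eps : R) (x0 a : X) :
  daugavet_property X -> (forall i, continuous (h i)) -> 0 < delta -> 0 < eps ->
  unit_ball X x0 -> rnorm a = 1 ->
  exists x, [/\ unit_ball X x,
    forall i, `|complex.Re (h i (x - x0))| < delta & 2 - eps < rnorm (a + x)].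
Proof.
move=> XD hc delta0 eps0 Bx0 a1; pose d := delta ^+ 2 / 5.
have d0 : 0 < d by rewrite divr_gt0// exprn_gt0.
have [y [By yP] yx0] := daugavet_approx_dense XD hc d0 Bx0.
have [x [Bx xy ax]] := yP a eps a1 eps0; exists x; split=> // i.
have qx : real_dot h (x - x0) (x - x0) < delta ^+ 2.
  have -> : x - x0 = (x - y) - (x0 - y) by rewrite opprB addrA subrK.
  set u := x - y in xy *; set v := x0 - y in yx0 *.
  clearbody u v.
  have := real_dot_ge0 h (u + v); rewrite !real_dotE (real_dotC h v u).
  by rewrite /d in xy yx0 d0; lra.
rewrite -(ltr_pXn2r (n := 2))// ?nnegrE ?normr_ge0 ?(ltW delta0)//.
rewrite real_normK ?num_real//; apply: le_lt_trans qx.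
rewrite /real_dot (bigD1 i)//= -expr2 lerDl; apply: sumr_ge0 => j _.
by rewrite -expr2 sqr_ge0.
Qed.

Lemma rnorm_le_Re_Im (R : realType) (z : R[i]) :
  rnorm (z : R[i]^o) <= `|complex.Re z| + `|complex.Im z|.
Proof.
rewrite /rnorm normc_def /= -[leRHS]ger0_norm ?addr_ge0// -sqrtr_sqr.
rewrite ler_wsqrtr// sqrrD !real_normK ?num_real// addrAC lerDl.
by rewrite mulrn_wge0// mulr_ge0.
Qed.

Lemma weak_nbhs_functionals (R : realType) (X : normedModType R[i]) (x0 : X)
    (A : set (weak X)) :
  nbhs (x0 : weak X) A ->
  exists (I : finType) (h : I -> {linear X -> R[i]^o}) (delta : R),
    [/\ forall i, continuous (h i), 0 < delta &
      forall x : X, (forall i, `|complex.Re (h i (x - x0))| < delta) -> A x].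
Proof.
move=> Ax0.
pose F : set_system X := [set A | exists (I : finType)
  (h : I -> {linear X -> R[i]^o}) (delta : R),
  [/\ forall i, continuous (h i), 0 < delta &
    forall x : X, (forall i, `|complex.Re (h i (x - x0))| < delta) -> A x]].
have FF : Filter F.
  split.
  - by exists void, (fun i : void => match i with end), 1; split=> // -[].
  - move=> P Q [I [h [d [hc d0 hP]]]] [J [k [e [kc e0 kQ]]]].
    exists (I + J)%type,
      (fun s => match s with inl i => h i | inr j => k j end), (Num.min d e).
    split=> [[]//||x xhk]; first by rewrite lt_min d0.
    split; [apply: hP => i; have := xhk (inl i)|apply: kQ => i; have := xhk (inr i)];
      by rewrite lt_min => /andP[].
  - move=> P Q PQ [I [h [d [hc d0 hP]]]]; exists I, h, d; split=> // x /hP.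
    exact: PQ.
suff : F --> (x0 : weak X) by apply.
apply/cvg_sup => -[f fc] U [V [[W oW <-] Wx0] VU]; apply: filterS VU _.
have /nbhs_normP[e /= e0 eW] : nbhs (f x0) W by exact: open_nbhs_nbhs.
move: e0; rewrite ltcE /= => /andP[/eqP Ime0 e0].
exists bool, (fun b => if b then f else ('i%C \*: f : {linear X -> R[i]^o})),
  (complex.Re e / 2); split.
- by case=> //= x; apply: cvgZl_tmp; exact: fc.
- by rewrite divr_gt0.
move=> x xf; apply: eW => /=.
have := xf false; have := xf true => /=.
move=> re im.
rewrite (normrE_rnorm (f x0 - f x : R[i]^o)) ltcE /= Ime0 eqxx /=.
rewrite -rnormN opprB -linearB; apply: le_lt_trans (rnorm_le_Re_Im _) _.
rewrite -[X in _ + X]normrN.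
have <- : complex.Re ('i%C * f (x - x0)) = - complex.Im (f (x - x0)).
  by case: (f (x - x0) : R[i]) => u v /=; rewrite mul0r mul1r sub0r.
by rewrite [ltRHS]splitr ltrD.
Qed.

Lemma daugavet_weakly_continuous (R : realType) (X Y : normedModType R[i])
    (P : X -> Y) (x0 a : X) (eta eps : R) :
  daugavet_property X -> weakly_continuous_on_bounded_sets P ->
  unit_ball X x0 -> rnorm a = 1 -> 0 < eta -> 0 < eps ->
  exists x, [/\ unit_ball X x, rnorm (P x - P x0) < eta &
                2 - eps < rnorm (a + x)].
Proof.
move=> XD Pc Bx0 a1 eta0 eps0.
have /(_ x0) := Pc _ (@unit_ball_bounded R X).
rewrite /continuous_at.
have V0 : nbhs (P x0) [set y | rnorm (y - P x0) < eta].
  apply/nbhs_normP; exists eta%:C; first by rewrite /= ltcR.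
  by move=> y /=; rewrite normrE_rnorm ltcR -rnormN opprB.
move=> /(_ _ V0); rewrite /= nbhs_filterE /= => Vx0.
have {}Vx0 : nbhs (x0 : weak X)
    [set x : weak X | unit_ball X x -> rnorm (P x - P x0) < eta].
  move: Vx0; rewrite /nbhs /= -nbhs_subspace_in//.
have [I [h [delta [hc delta0 hV]]]] := weak_nbhs_functionals Vx0.
have [x [Bx xh ax]] := daugavet_weak_nbhs XD hc delta0 eps0 Bx0 a1.
by exists x; split=> //; apply: hV.
Qed.

Lemma diagonal_continuous (T : topologicalType) (N : nat) :
  continuous ((fun x _ => x) : T -> {ptws 'I_N -> T}).
Proof.
move=> x; apply/cvg_sup => i U [V [[W oW <-] Wx] VU].
apply: filterS VU _; exact: open_nbhs_nbhs.
Qed.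

Lemma multilinear_scale (R : realType) (X Y : normedModType R[i]) (N : nat)
    (T : ('I_N -> X) -> Y) (c : R[i]) (x : X) :
  multilinear T -> T (fun=> c *: x) = c ^+ N *: T (fun=> x).
Proof.
move=> Tl.
pose z k (i : 'I_N) := if (i < k)%N then c *: x else x.
suff zE k : (k <= N)%N -> T (z k) = c ^+ k *: T (fun=> x).
  rewrite -zE//; congr T; apply: funext => i; by rewrite /z ltn_ord.
elim: k => [_|k IH kN].
  by rewrite expr0 scale1r; congr T; apply: funext.
have zS u : dfwith (z k) (Ordinal kN) u =
    (fun i : 'I_N => if i == k :> nat then u else z k i).
  apply: funext => i; case: dfwithP => [|j]; first by rewrite eqxx.
  by rewrite -val_eqE /= eq_sym => /negPf ->.
have -> : z k.+1 = dfwith (z k) (Ordinal kN) (c *: x).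
  rewrite zS; apply: funext => i; rewrite /z ltnS leq_eqVlt.
  by case: eqP.
have zk : z k = dfwith (z k) (Ordinal kN) x.
  by rewrite zS; apply: funext => i; rewrite /z; case: eqP => // ->; rewrite ltnn.
rewrite exprS -scalerA -IH ?(ltnW kN)// [in RHS]zk.
pose f : {linear X -> Y} := HB.pack (fun u => T (dfwith (z k) (Ordinal kN) u))
  (GRing.isLinear.Build R[i] X Y _ _ (Tl (z k) (Ordinal kN))).
exact: (linearZZ f c x).
Qed.

Lemma homogeneous_polynomial_bounded (R : realType) (X Y : normedModType R[i])
    (N : nat) (P : X -> Y) :
  homogeneous_polynomial N P ->
  exists M, forall x, unit_ball X x -> rnorm (P x) <= M.
Proof.
move=> [T [Tc _ Tl PT]].
have Pc : P @ 0 --> P 0.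
  have -> : P = T \o (fun x _ => x) by apply: funext.
  exact: (continuous_comp (@diagonal_continuous X N 0) (Tc _)).
have /Pc /nbhs_norm0P[e /= e0 eP] : nbhs (P 0) [set y | rnorm (y - P 0) < 1].
  apply/nbhs_normP; exists 1 => //= y /=.
  by rewrite normrE_rnorm -[1]/(1%:C) ltcR -rnormN opprB.
move: e0; rewrite ltcE /= => /andP[/eqP Ime e0].
pose r := complex.Re e / 2; have r0 : 0 < r by rewrite divr_gt0.
exists (rnorm ((r^-1)%:C ^+ N : R[i]^o) * (1 + rnorm (P 0))) => x Bx.
have xE : x = r^-1%:C *: (r%:C *: x).
  by rewrite scalerA -rmorphM /= mulVf ?gt_eqF// scale1r.
rewrite {1}xE PT multilinear_scale// -PT rnormZ.
apply: ler_wpM2l; first exact: rnorm_ge0.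
have : rnorm (P (r%:C *: x) - P 0) < 1.
  apply: eP => /=; rewrite normrE_rnorm ltcE /= Ime eqxx /=.
  rewrite rnormZr gtr0_norm//; apply: le_lt_trans (_ : r * 1 < _).
    by rewrite ler_pM2l.
  by rewrite mulr1 /r; lra.
by have := rnormD (P (r%:C *: x) - P 0) (P 0); rewrite subrK; lra.
Qed.

Lemma polynomial_map_bounded (R : realType) (X Y : normedModType R[i])
    (P : X -> Y) :
  polynomial_map P -> exists M, forall x, unit_ball X x -> rnorm (P x) <= M.
Proof.
move=> [n [deg [Q [Qh PQ]]]].
have /choice[M hM] k := homogeneous_polynomial_bounded (Qh k).
exists (\sum_k M k) => x Bx; rewrite PQ; apply: le_trans (rnorm_sum _ _) _.
by apply: ler_sum => k _; exact: hM.
Qed.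

Theorem theorem2p3 (R : realType) (X : completeNormedModType R[i])
    (X_neq0 : exists x : X, x != 0) (X_daugavet : daugavet_property X) :
  (forall p : X -> R[i]^o,
     polynomial_map p -> weakly_continuous_on_bounded_sets p ->
     sup_norm p = 1 ->
   forall a : X, rnorm a = 1 ->
   forall eps : R, 0 < eps ->
   exists (x : X) (w : R[i]),
     [/\ unit_ball X x, `|w| = 1,
         complex.Re (w * p x) > 1 - eps &
         rnorm (a + w *: x) > 2 - eps]) /\
  (forall P : X -> X,
     polynomial_map P -> weakly_compact P ->
     weakly_continuous_on_bounded_sets P ->
     sup_norm (fun x => x + P x) = 1 + sup_norm P).
Proof.
split=> [p _ pc p1 a a1 eps eps0|P Pp _ Pc].
  have e2 : 0 < eps / 2 by rewrite divr_gt0.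
  have : 1 - eps / 2 < sup_norm p by rewrite p1; lra.
  move=> /sup_norm_adherent[x0 Bx0 x0p].
  have [w w1 wp] := exists_rotation (p x0).
  have w0 : w != 0 by rewrite -normr_eq0 w1 oner_eq0.
  have wa1 : rnorm (w^-1 *: a) = 1 by rewrite rnorm_unit// normfV w1 invr1.
  have [x [Bx xp ax]] := daugavet_weakly_continuous X_daugavet pc Bx0 wa1 e2 eps0.
  exists x, w; split=> //.
    have -> : w * p x = w * p x0 + w * (p x - p x0) by rewrite -mulrDr addrC subrK.
    rewrite ReD wp /=; have := Re_le_rnorm (w * (p x - p x0)).
    have := ler_norm (- complex.Re (w * (p x - p x0))); rewrite normrN.
    have -> : rnorm (w * (p x - p x0) : R[i]^o) = rnorm (p x - p x0).
      exact: (rnorm_unit (p x - p x0) w1).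
    lra.
  suff -> : a + w *: x = w *: (w^-1 *: a + x) by rewrite rnorm_unit.
  by rewrite scalerDr scalerA divff// scale1r.
have [M PM] := polynomial_map_bounded Pp.
have Psup := sup_norm_upper_bound PM.
have IPM x : unit_ball X x -> rnorm (x + P x) <= 1 + sup_norm P.
  move=> Bx; apply: le_trans (rnormD _ _) _; rewrite lerD//; exact: Psup.
apply/eqP; rewrite eq_le sup_norm_le//=.
have IPsup := sup_norm_upper_bound IPM.
apply/ler_addgt0Pr => eps eps0.
have e4 : 0 < eps / 4 by rewrite divr_gt0.
have : sup_norm P - eps / 4 < sup_norm P by rewrite ltrBlDr ltrDl.
move=> /sup_norm_adherent[x0 Bx0 x0P].
have [a a1 Pa] : exists2 a, rnorm a = 1 & P x0 = (rnorm (P x0))%:C *: a.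
  have unit (y : X) : y != 0 ->
      exists2 a, rnorm a = 1 & y = (rnorm y)%:C *: a.
    rewrite -rnorm_gt0 => y0; exists ((rnorm y)^-1%:C *: y).
      by rewrite rnormZr gtr0_norm ?invr_gt0// mulVf// gt_eqF.
    by rewrite scalerA -rmorphM divff ?gt_eqF// scale1r.
  have [P0|/unit//] := eqVneq (P x0) 0.
  have [y /unit[a a1 _]] := X_neq0; exists a => //.
  by rewrite P0 rnorm0 scale0r.
set s := rnorm (P x0) in x0P Pa.
have s0 : 0 <= s by exact: rnorm_ge0.
pose e := eps / (4 * (1 + s)).
have eE : e * (4 * (1 + s)) = eps by rewrite divfK// gt_eqF//; lra.
have e0 : 0 < e by rewrite divr_gt0//; lra.
have [x [Bx xP ax]] := daugavet_weakly_continuous X_daugavet Pc Bx0 a1 e4 e0.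
have := IPsup x Bx.
have := rnormB (x + P x) (P x - P x0).
have -> : x + P x - (P x - P x0) = x + s%:C *: a by rewrite -Pa opprB addrA addrAC addrK.
suff : 1 + s - (1 + s) * e <= rnorm (x + s%:C *: a) by lra.
have [s1|s1] := leP s 1.
  have := rnormD (x + s%:C *: a) ((1 - s)%:C *: a).
  have -> : x + s%:C *: a + (1 - s)%:C *: a = a + x.
    by rewrite -addrA -scalerDl -rmorphD addrCA subrr addr0 scale1r addrC.
  by rewrite rnormZr a1 ger0_norm ?subr_ge0//; nra.
have := rnormD (x + s%:C *: a) ((s - 1)%:C *: x).
have -> : x + s%:C *: a + (s - 1)%:C *: x = s%:C *: (a + x).
  by rewrite rmorphB /= scalerBl scale1r scalerDr addrC addrA subrK addrC.
rewrite !rnormZr !ger0_norm ?subr_ge0 ?(ltW s1)//.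
have : s * (2 - e) < s * rnorm (a + x) by rewrite ltr_pM2l//; lra.
have : (s - 1) * rnorm x <= s - 1 by rewrite ler_piMr// subr_ge0 ltW.
lra.
Qed.
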